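(* Let $G$ be a connected graph with $n\geq 2$ vertices and $m$ edges. Then for every integer $k\geq 0$, $$R^+(S^k(G))=4^kR^+(G)+(8^k-4^k)R^*(G)+\frac{8^k-2^k}{3}m(2m-2n+1)-\frac{4^k-1}{3}(m-n)(m-n+1).$$
   Context: All graphs are finite, undirected, without loops or multiple edges. For a connected graph $H$ and vertices $i,j$, the resistance distance $\Omega_{ij}$ is the effective resistance between $i$ and $j$ in the electrical network obtained from $H$ by replacing each edge by a unit resistor. With $d_i$ the degree of vertex $i$ in $H$ and sums over unordered pairs of distinct vertices of $H$: $R^+(H)=\sum_{\{i,j\}\subseteq V(H)}(d_i+d_j)\Omega_{ij}$ (additive degree-Kirchhoff index) and $R^*(H)=\sum_{\{i,j\}\subseteq V(H)}d_id_j\Omega_{ij}$ (multiplicative degree-Kirchhoff index), with degrees and resistances taken in $H$. The subdivision $S(H)$ is the graph obtained from $H$ by replacing every edge with a path of length two. Iterated subdivisions: $S^0(G)=G$ and $S^k(G)=S(S^{k-1}(G))$ for $k\geq1$. *)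

(* Defs.v *)
From HB Require Import structures.
From mathcomp Require Import all_boot all_order all_algebra.
Unset Printing Implicit Defensive.
Import Order.TTheory GRing.Theory Num.Theory.
Local Open Scope ring_scope.

(* A finite graph on vertex set {0,...,gn-1}, given by a list of edges
   (each unordered edge listed once as a pair of endpoints). *)
Record graph := Graph { gn : nat; gedges : seq (nat * nat) }.

Definition simple_graph (G : graph) : bool :=
  all (fun p => [&& (p.1 < gn G)%N, (p.2 < gn G)%N & p.1 != p.2]) (gedges G)
  && uniq [seq (minn p.1 p.2, maxn p.1 p.2) | p <- gedges G].

Definition adjb (G : graph) (i j : nat) : bool :=
  has (fun p => (p == (i, j)) || (p == (j, i))) (gedges G).

Definition gadj (G : graph) : rel 'I_(gn G) := fun i j => adjb G (nat_of_ord i) (nat_of_ord j).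

Definition gconnected (G : graph) : Prop :=
  forall i j : 'I_(gn G), connect (gadj G) i j.

Definition gm (G : graph) : nat := size (gedges G).

Definition deg (G : graph) (i : nat) : nat :=
  count (fun p => (p.1 == i) || (p.2 == i)) (gedges G).

Definition laplacian (R : fieldType) (G : graph) : 'M[R]_(gn G) :=
  \matrix_(i, j) (if i == j then (deg G i)%:R
                  else if adjb G i j then -1 else 0).

(* Resistance distance between i and j: inject a unit current at i and
   extract it at j; the vertex potentials x solve (Kirchhoff) x L = e_i - e_j,
   and Omega_ij = x_i - x_j.  (pinvmx gives a solution whenever one exists,
   which is the case for connected graphs; x_i - x_j does not depend on the
   solution chosen.) *)
Definition resistance (R : fieldType) (G : graph) (i j : 'I_(gn G)) : R :=
  let b : 'rV[R]_(gn G) := \row_k ((k == i)%:R - (k == j)%:R) in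
  let x := b *m pinvmx (laplacian R G) in
  x 0 i - x 0 j.

Definition Rplus (R : fieldType) (G : graph) : R :=
  \sum_(i < gn G) \sum_(j < gn G | (i < j)%N)
     ((deg G i)%:R + (deg G j)%:R) * resistance R G i j.

Definition Rstar (R : fieldType) (G : graph) : R :=
  \sum_(i < gn G) \sum_(j < gn G | (i < j)%N)
     ((deg G i)%:R * (deg G j)%:R) * resistance R G i j.

Definition subdiv (G : graph) : graph :=
  Graph (gn G + gm G)
    (flatten (mkseq (fun k => let p := nth (0, 0)%N (gedges G) k in
                      [:: (p.1, gn G + k); (gn G + k, p.2)]%N) (gm G))).

Definition subdiv_iter (k : nat) (G : graph) : graph := iter k subdiv G.

(* Main.v *)
(* For the subdivision S(G), eliminating a midpoint w of an edge uv moves half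
   of the current injected at w to each of u and v, and leaves the network G
   with every resistance doubled.  Writing phi_a for the vector of G on which a
   unit of current injected at a is distributed, this gives
     Omega'_ab = 2 Omega(phi_a, phi_b) + t_a + t_b - [a = b] 2 s_a,
   where Omega(f, g) = sum_ij f_i g_j Omega_ij, s is 1/2 on midpoints and 0 on
   old vertices, and t_a = s_a - Omega(phi_a, phi_a).  Summing against degree
   weights, with Foster's theorem (the resistances over the edges add up to
   n - 1) for the sum of t, yields for c = m - n
     R*(S(G)) = 8 R*(G) + 2 m (2c + 1),
     R+(S(G)) = 4 R+(G) + 4 R*(G) + 2 m (2c + 1) - c (c + 1),
   and c is invariant under subdivision. *)
Require Import Defs.
From HB Require Import structures.
From mathcomp Require Import all_boot all_order all_algebra.
From mathcomp Require Import zify ring lra.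
Import Order.TTheory GRing.Theory Num.Theory.
Local Open Scope ring_scope.

(** * Edges, degrees and the Laplacian as sums over edges *)

Definition edge (G : graph) (k : nat) : nat * nat := nth (0, 0)%N (gedges G) k.

(** Column of the signed incidence matrix; each edge is oriented as the list stores it. *)
Definition incidence {R : fieldType} (p : nat * nat) (i : nat) : R :=
  (p.1 == i)%:R - (p.2 == i)%:R.

(* [x u], extended by [0] to [u >= n]; edges carry endpoints in [nat]. *)
Definition at_nat {R : fieldType} {n} (x : 'I_n -> R) (u : nat) : R :=
  \sum_i x i * (u == i)%:R.

Lemma at_natE {R : fieldType} {n} (x : 'I_n -> R) (u : 'I_n) : at_nat x u = x u.
Proof.
rewrite /at_nat (bigD1 u) //= eqxx mulr1 big1 ?addr0 // => i.
by rewrite eq_sym -val_eqE /= => /negbTE ->; rewrite mulr0.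
Qed.

Lemma sum_incidence {R : fieldType} {n} (x : 'I_n -> R) p :
  \sum_i x i * incidence p i = at_nat x p.1 - at_nat x p.2.
Proof. by rewrite /at_nat -sumrB; apply: eq_bigr => i _; rewrite mulrBr. Qed.

Lemma sum_edges {R : fieldType} G (F : nat * nat -> R) :
  \sum_(p <- gedges G) F p = \sum_(k < gm G) F (edge G k).
Proof. by rewrite (big_nth (0, 0)%N) big_mkord. Qed.

Lemma edge_bounds G k : simple_graph G -> (k < gm G)%N ->
  [/\ ((edge G k).1 < gn G)%N, ((edge G k).2 < gn G)%N
    & (edge G k).1 != (edge G k).2].
Proof. by case/andP=> /allP hG _ hk; apply/and3P/hG/mem_nth. Qed.

Lemma edge_ends G k : simple_graph G -> (k < gm G)%N ->
  exists u v : 'I_(gn G), u != v /\ edge G k = (val u, val v).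
Proof.
move=> sG /(edge_bounds G _ sG) [hu hv huv].
by exists (Ordinal hu), (Ordinal hv); split=> //; exact: surjective_pairing.
Qed.

(** Without loops at most one end of an edge is [i], so the disjunction counted by [deg] is a sum of
    two indicators. *)
Lemma degE {R : fieldType} G (i : nat) : simple_graph G ->
  (deg G i)%:R = \sum_(k < gm G)
    (((edge G k).1 == i)%:R + ((edge G k).2 == i)%:R) :> R.
Proof.
move=> sG; rewrite -(sum_edges G (fun p => (p.1 == i)%:R + (p.2 == i)%:R)).
rewrite /deg -sum1_count natr_sum big_mkcond /=; case/andP: sG => /allP hG _.
rewrite big_seq [RHS]big_seq; apply: eq_bigr => p /hG /and3P [_ _].
case: p => a b /=; case: (a =P i) => [->|_] /= nab; last by rewrite add0r; case: eqP.
by rewrite eq_sym (negbTE nab) addr0.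
Qed.

(** The factorization of the Laplacian through the incidence matrix. Off the diagonal, an edge
    joining [i] and [j] contributes -1, and simplicity allows only one such edge. *)
Lemma laplacianE {R : fieldType} G (i j : 'I_(gn G)) : simple_graph G ->
  laplacian R G i j
  = \sum_(k < gm G) incidence (edge G k) i * incidence (edge G k) j.
Proof.
move=> sG; rewrite mxE; case: eqP => [<-|/eqP nij].
  rewrite (degE _ _ sG); apply: eq_bigr => k _.
  have [u [v [nuv ->]]] := edge_ends G k sG (ltn_ord k).
  rewrite /incidence /= !val_eqE.
  case: (u =P i) nuv => [->|_] nuv; last by case: eqP => /= _; ring.
  by rewrite (negbTE (_ : v != i)) 1?eq_sym //=; ring.
rewrite -(sum_edges G (fun p => incidence p i * incidence p j)).
(* A boolean can be traded for a count because the sorted pair of [i] and [j] occurs at most once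
   among the sorted edges. *)
have hcount : (adjb G i j)%:R = (count (fun p => (p == (i : nat, j : nat))
    || (p == (j : nat, i : nat))) (gedges G))%:R :> R.
  rewrite /adjb has_count; congr (_%:R).
  set c := count _ _; suff: (c <= 1)%N by case: c => [|[]].
  case/andP: sG => _ uG.
  have := count_uniq_mem (minn i j, maxn i j) uG; rewrite count_map => hc.
  apply: (@leq_trans (count (preim (fun p : nat * nat => (minn p.1 p.2, maxn p.1 p.2))
     (pred1 (minn i j, maxn i j))) (gedges G))); last by rewrite hc leq_b1.
  apply: sub_count => -[a b] /= /orP [] /eqP [-> ->] //.
  by rewrite minnC maxnC.
have -> : (if adjb G i j then -1 else 0) = - (adjb G i j)%:R :> R.
  by case: adjb; rewrite ?oppr0.
rewrite hcount -sum1_count natr_sum big_mkcond -sumrN; apply: eq_bigr => -[a b] _.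
rewrite /incidence /= !xpair_eqE.
have excl x : ~~ ((x == i :> nat) && (x == j :> nat)).
  by apply/negP => /andP [/eqP -> /eqP /val_inj /eqP]; rewrite (negbTE nij).
move: (excl a) (excl b).
by case: (a == i :> nat); case: (a == j :> nat); case: (b == i :> nat);
  case: (b == j :> nat) => //= _ _; ring.
Qed.

Lemma laplacian_mull {R : fieldType} G (x : 'rV[R]_(gn G)) j : simple_graph G ->
  (x *m laplacian R G) 0 j = \sum_(k < gm G)
   (at_nat (x 0) (edge G k).1 - at_nat (x 0) (edge G k).2) * incidence (edge G k) j.
Proof.
move=> sG; rewrite mxE.
under eq_bigr do rewrite laplacianE // mulr_sumr.
rewrite exchange_big /=; apply: eq_bigr => k _.
rewrite -sum_incidence mulr_suml; apply: eq_bigr => i _; ring.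
Qed.

Lemma laplacian_tr {R : fieldType} G : simple_graph G ->
  (laplacian R G)^T = laplacian R G.
Proof.
move=> sG; apply/matrixP => i j; rewrite mxE !laplacianE //.
by apply: eq_bigr => k _; rewrite mulrC.
Qed.

(** * Solvability of Kirchhoff's equations *)

Definition dipole {R : fieldType} {n} (i j : 'I_n) : 'rV[R]_n :=
  \row_k ((k == i)%:R - (k == j)%:R).

(** The form in which connectedness is used: [pinvmx] then returns genuine potentials. It passes to
    the subdivision by exhibiting potentials there, with no path to construct. *)
Definition solvable_graph (R : fieldType) G :=
  forall i j : 'I_(gn G), (dipole i j <= laplacian R G)%MS.

Lemma dipole_mulr {R : fieldType} {n} {p} (i j : 'I_n) (A : 'M[R]_(n, p)) l :
  (dipole i j *m A) 0 l = A i l - A j l.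
Proof.
rewrite mxE; under eq_bigr do rewrite mxE mulrBl.
rewrite sumrB (bigD1 i) //= [X in _ - X](bigD1 j) //= !eqxx !mul1r.
by rewrite !big1 ?addr0 // => k /negbTE ->; rewrite mul0r.
Qed.

(** A column of the cokernel is killed by the symmetric Laplacian, so its energy, the sum of squared
    differences along edges, vanishes. Over an ordered field it is then constant along edges, hence
    along paths, and every dipole annihilates it. *)
Lemma connected_solvable {R : realFieldType} G :
  simple_graph G -> gconnected G -> solvable_graph R G.
Proof.
move=> sG cG i j; rewrite submxE; apply/eqP/rowP => l.
rewrite [RHS]mxE -[RHS](subrr (cokermx (laplacian R G) j l)).
set C := cokermx _.
rewrite dipole_mulr; congr (_ - _).
have key (a b : 'I_(gn G)) : gadj G a b -> C a l = C b l.
  move=> hab; pose x := \row_a C a l.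
  have hx : x *m laplacian R G = 0.
    apply/rowP => z; transitivity ((laplacian R G *m C) z l).
      rewrite [LHS]mxE [RHS]mxE; apply: eq_bigr => y _; rewrite [x _ _]mxE mulrC.
      by rewrite -{1}(laplacian_tr G sG) [in LHS]mxE.
    by rewrite mulmx_coker [LHS]mxE [RHS]mxE.
  have : \sum_(k < gm G) (at_nat (x 0) (edge G k).1 - at_nat (x 0) (edge G k).2) ^+ 2 = 0.
    transitivity (\sum_z (x *m laplacian R G) 0 z * x 0 z); last first.
      by rewrite hx big1 // => z _; rewrite mxE mul0r.
    under [RHS]eq_bigr do rewrite laplacian_mull // mulr_suml.
    rewrite exchange_big /=; apply: eq_bigr => k _.
    rewrite expr2 -{2}sum_incidence mulr_sumr; apply: eq_bigr => z _; ring.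
  move/eqP; rewrite psumr_eq0 => [/allP hk|k _]; last exact: sqr_ge0.
  have ha z : C z l = at_nat (x 0) z by rewrite at_natE [RHS]mxE.
  case/hasP: hab => p /(nthP (0, 0)%N) [k kG hp] hab.
  have := hk (Ordinal kG) (mem_index_enum _); rewrite /= ?implyTb.
  rewrite sqrf_eq0 subr_eq0 /= /edge hp => /eqP.
  by rewrite !ha; case/orP: hab => /eqP ->.
have /connectP [s] := cG i j; elim: s i => [|a s IH] i /= => [_ -> //|/andP [hia hs] hj].
by rewrite (key _ _ hia); apply: IH.
Qed.

(** * Resistances, weighted resistances and Foster's theorem *)

Lemma resistanceE {R : fieldType} G (i j : 'I_(gn G)) (P := pinvmx (laplacian R G)) :
  resistance R G i j = P i i + P j j - P i j - P j i.
Proof.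
by rewrite /resistance -/(dipole i j) !dipole_mulr -/P; ring.
Qed.

Lemma resistance_sym {R : fieldType} G i j : resistance R G i j = resistance R G j i.
Proof. by rewrite !resistanceE; ring. Qed.

Lemma resistance_diag {R : fieldType} G i : resistance R G i i = 0.
Proof. by rewrite !resistanceE; ring. Qed.

(* If [x L = y L = b] then, by symmetry of [L],
   [(y - x) b^T = ((y - x) L) x^T = 0]. *)
Lemma resistance_potential {R : fieldType} G (i j : 'I_(gn G)) (x : 'rV[R]_(gn G)) :
  simple_graph G -> x *m laplacian R G = dipole i j ->
  resistance R G i j = x 0 i - x 0 j.
Proof.
move=> sG hx; rewrite /resistance -/(dipole i j); set y := dipole i j *m _.
have hy : (y - x) *m laplacian R G = 0.
  by rewrite mulmxBl hx mulmxKpV ?subrr // -hx submxMl.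
clearbody y.
have : (dipole i j *m (y - x)^T) 0 0 = 0.
  by rewrite -hx -mulmxA -[X in _ *m X]trmxK trmx_mul trmxK (laplacian_tr _ sG) hy trmx0 mulmx0 mxE.
rewrite dipole_mulr !mxE; move=> h; apply/eqP; rewrite -subr_eq0 -h; apply/eqP; ring.
Qed.

(** A balanced injection of current is a combination of dipoles with the common sink [i0]. *)
Lemma balanced_submx {R : fieldType} G (i0 : 'I_(gn G)) (c : 'rV[R]_(gn G)) :
  solvable_graph R G -> \sum_i c 0 i = 0 -> (c <= laplacian R G)%MS.
Proof.
move=> hG hc; suff -> : c = \sum_i c 0 i *: dipole i i0.
  by apply: summx_sub => i _; apply: scalemx_sub; apply: hG.
apply/rowP => j; rewrite summxE.
under eq_bigr do rewrite !mxE mulrBr.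
rewrite sumrB -mulr_suml hc mul0r subr0 (bigD1 j) //= eqxx mulr1 big1 ?addr0 // => i.
by rewrite eq_sym => /negbTE ->; rewrite mulr0.
Qed.

(** The Omega(f, g) of the header, over ordered pairs. *)
Definition weighted_resistance {R : fieldType} G (f g : 'I_(gn G) -> R) : R :=
  \sum_i \sum_j f i * g j * resistance R G i j.

(** With [resistanceE], the terms [P i i] and [P j j] involve one index only and vanish against a
    zero total; the two mixed terms agree after exchanging the indices. *)
Lemma weighted_resistance_balanced {R : fieldType} G (c : 'I_(gn G) -> R) :
  \sum_i c i = 0 -> weighted_resistance G c c
  = - 2 * \sum_i \sum_j c i * c j * pinvmx (laplacian R G) i j.
Proof.
set P := pinvmx _ => hc.
have -> : weighted_resistance G c c =
    \sum_i \sum_j (c i * P i i) * c j + \sum_i \sum_j c i * (c j * P j j)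
    - \sum_i \sum_j c i * c j * P i j - \sum_i \sum_j c j * c i * P j i.
  rewrite -!sumrN -!big_split; apply: eq_bigr => i _.
  rewrite -!sumrN -!big_split; apply: eq_bigr => j _ /=.
  rewrite resistanceE -/P; ring.
rewrite [X in _ - X]exchange_big /= big1 => [|i _]; last by rewrite -mulr_sumr hc mulr0.
rewrite exchange_big big1 => [|j _] /=; last by rewrite -mulr_suml hc mul0r.
ring.
Qed.

(* [L (1 - P L) = 0] makes every column of [1 - P L] constant, so its trace is
   the sum of any of its rows, which is [1] because [L] kills constants. *)
Lemma mxtrace_pinv_laplacian {R : fieldType} G (i0 : 'I_(gn G)) :
  simple_graph G -> solvable_graph R G ->
  \tr (pinvmx (laplacian R G) *m laplacian R G) = (gn G)%:R - 1.
Proof.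
move=> sG hG; set L := laplacian R G; set P := pinvmx L.
pose N := 1%:M - P *m L.
have hLN : L *m N = 0 by rewrite mulmxBr mulmx1 mulmxA mulmxKpV ?subrr.
have hN i j : N i j = N i0 j.
  apply/eqP; rewrite -subr_eq0 -dipole_mulr.
  by have /submxP [D ->] := hG i i0; rewrite -mulmxA hLN mulmx0 mxE.
have hrow i : \sum_j L i j = 0.
  under eq_bigr do rewrite /L (laplacianE G _ _ sG).
  rewrite exchange_big big1 // => k _; rewrite -mulr_sumr.
  have [u [v [_ ->]]] := edge_ends G k sG (ltn_ord k).
  under eq_bigr do rewrite -[incidence _ _]mul1r.
  by rewrite (sum_incidence (fun=> 1)) !at_natE subrr mulr0.
have hN1 : \tr N = 1.
  rewrite /mxtrace; under eq_bigr do rewrite hN !mxE.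
  rewrite sumrB exchange_big /= (bigD1 i0) //= eqxx big1 => [|i /negbTE]; last first.
    by rewrite eq_sym => ->.
  rewrite big1 => [|k _]; first by rewrite addr0 subr0.
  by rewrite -mulr_sumr hrow mulr0.
have -> : P *m L = 1%:M - N by rewrite /N; apply/matrixP => i j; rewrite !mxE; ring.
by rewrite linearB /= hN1 mxtrace1.
Qed.

(* Foster's theorem: each summand is [-2] times the resistance of the edge. *)
Lemma sum_edge_balanced {R : fieldType} G (i0 : 'I_(gn G)) :
  simple_graph G -> solvable_graph R G ->
  \sum_(k < gm G) weighted_resistance G (incidence (edge G k)) (incidence (edge G k))
  = - 2 * ((gn G)%:R - 1) :> R.
Proof.
move=> sG hG; rewrite -(mxtrace_pinv_laplacian G i0) // /mxtrace.
transitivity (- 2 * \sum_(k < gm G) \sum_(i < gn G) \sum_(j < gn G) incidence (edge G k) i *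
   incidence (edge G k) j * pinvmx (laplacian R G) i j).
  rewrite mulr_sumr; apply: eq_bigr => k _.
  rewrite -weighted_resistance_balanced //.
  have [u [v [_ ->]]] := edge_ends G k sG (ltn_ord k).
  under eq_bigr do rewrite -[incidence _ _]mul1r.
  by rewrite (sum_incidence (fun=> 1)) !at_natE subrr.
(* Summed over the edges, the incidence products rebuild the Laplacian, and the double sum becomes
   the trace. *)
congr (_ * _); rewrite exchange_big; apply: eq_bigr => i _ /=.
rewrite exchange_big [RHS]mxE; apply: eq_bigr => j _ /=.
rewrite laplacianE // mulr_sumr; apply: eq_bigr => k _; ring.
Qed.

(** * The Kirchhoff indices as weighted resistances *)

Lemma resistance_index {R : realFieldType} G (c : 'I_(gn G) -> 'I_(gn G) -> R) :
  (forall i j, c i j = c j i) ->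
  \sum_(i < gn G) \sum_(j < gn G | (i < j)%N) c i j * resistance R G i j =
  2^-1 * \sum_i \sum_j c i j * resistance R G i j.
Proof.
move=> csym; set S := LHS.
have -> : \sum_i \sum_j c i j * resistance R G i j = S + S; last by field.
have {2}-> : S = \sum_(i < gn G) \sum_(j < gn G | (j < i)%N) c i j * resistance R G i j.
  rewrite /S (exchange_big_dep xpredT) //=; apply: eq_bigr => i _.
  by apply: eq_bigr => j _; rewrite csym resistance_sym.
rewrite -big_split; apply: eq_bigr => i _ /=.
rewrite (bigID (fun j : 'I__ => (i < j)%N)) /=; congr (_ + _).
rewrite (bigD1 i) ?ltnn //= resistance_diag mulr0 add0r; apply: eq_bigl => j.
by rewrite -leqNgt ltn_neqAle andbC.
Qed.

Lemma RstarE {R : realFieldType} G (d := fun i => (deg G i)%:R : R) :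
  Rstar R G = 2^-1 * weighted_resistance G d d.
Proof. by rewrite /Rstar resistance_index // => i j; rewrite mulrC. Qed.

(** No factor 1/2 remains: by symmetry the two summands of the weight contribute equally. *)
Lemma RplusE {R : realFieldType} G (d := fun i => (deg G i)%:R : R) :
  Rplus R G = weighted_resistance G d (fun=> 1).
Proof.
rewrite /Rplus resistance_index => [|i j]; last by rewrite addrC.
rewrite /weighted_resistance; set S := RHS.
suff -> : \sum_(i < gn G) \sum_(j < gn G) ((deg G i)%:R + (deg G j)%:R) * resistance R G i j = S + S by field.
have {2}-> : S = \sum_(i < gn G) \sum_(j < gn G) (deg G j)%:R * 1 * resistance R G i j.
  rewrite /S exchange_big; apply: eq_bigr => i _; apply: eq_bigr => j _ /=.
  by rewrite resistance_sym.
rewrite -big_split; apply: eq_bigr => i _; rewrite -big_split; apply: eq_bigr => j _ /=.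
by rewrite !mulr1 mulrDl.
Qed.

(** * Edges of the subdivision *)

Lemma simple_subdiv G : simple_graph G -> simple_graph (subdiv G).
Proof.
move=> sG; apply/andP; split.
  apply/allP => p /flatten_mapP [k]; rewrite mem_iota /= add0n => kG.
  have [hu hv _] := edge_bounds G k sG kG.
  by rewrite !inE => /orP [] /eqP -> /=; rewrite -/(edge G k); lia.
rewrite [gedges _]/=; set h := (X in mkseq X _).
have hmin u k : (u < gn G)%N -> (minn u (gn G + k) = u) * (maxn u (gn G + k) = gn G + k)%N
  by move=> hu; split; lia.
have hnorm k : (k < gm G)%N -> [seq (minn p.1 p.2, maxn p.1 p.2) | p <- h k]
    = [:: ((edge G k).1, gn G + k); ((edge G k).2, gn G + k)]%N.
  move=> kG; have [hu hv _] := edge_bounds G k sG kG.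
  by rewrite /h /= -/(edge G k) !hmin // minnC maxnC !hmin.
(* Induction on the number [M] of edges already subdivided, with [G] and the midpoint labels fixed.
   The midpoint [gn G + M] is fresh, and its two edges differ because the ends of edge [M] do. *)
have [M hM] : exists M, M = gm G by exists (gm G).
rewrite -hM; have : (M <= gm G)%N by rewrite hM.
elim: M {hM} => // M IH MG.
rewrite mkseqS flatten_rcons map_cat cat_uniq IH 1?ltnW // hnorm //.
have [_ _ huv] := edge_bounds G M sG MG.
rewrite /= inE xpair_eqE negb_and huv /= andbT orbF negb_or.
suff new x : (x, gn G + M)%N \notin
    [seq (minn p.1 p.2, maxn p.1 p.2) | p <- flatten (mkseq h M)] by rewrite !new.
rewrite map_flatten -map_comp; apply/negP => /flatten_mapP [k].
rewrite mem_iota add0n /comp => /andP [_ kM]; rewrite hnorm ?(ltn_trans kM) //.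
by rewrite !inE => /orP [] /eqP [_]; lia.
Qed.

Lemma gm_subdiv G : gm (subdiv G) = (2 * gm G)%N.
Proof.
rewrite {1}/gm /= size_flatten /shape -map_comp sumnE big_map.
by rewrite -[X in iota _ X]subn0 big_mkord /= sum_nat_const card_ord mulnC.
Qed.

Lemma sum_edges_subdiv {R : fieldType} G (F : nat * nat -> R) :
  \sum_(k < gm (subdiv G)) F (edge (subdiv G) k) = \sum_(k < gm G)
   (F ((edge G k).1, gn G + k)%N + F (gn G + k, (edge G k).2)%N).
Proof.
rewrite -sum_edges /= big_flatten /= big_map -[X in iota _ X]subn0 big_mkord.
by apply: eq_bigr => k _; rewrite !big_cons big_nil addr0.
Qed.

(** * Old vertices, midpoints and the reduction of the network to [G] *)

Lemma at_nat_old {R : fieldType} n m (x : 'I_(n + m) -> R) (u : 'I_n) :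
  at_nat x u = x (lshift m u).
Proof. exact: (at_natE x (lshift m u)). Qed.

Lemma at_nat_new {R : fieldType} n m (x : 'I_(n + m) -> R) (k : 'I_m) :
  at_nat x (n + k)%N = x (rshift n k).
Proof. exact: (at_natE x (rshift n k)). Qed.

(* [anchor G a] and [half_new G a] are the phi_a and s_a of the header. *)
Definition anchor {R : fieldType} G (a : 'I_(gn G + gm G)) (i : 'I_(gn G)) : R :=
  match split a with
  | inl j => (j == i)%:R
  | inr k => 2^-1 * (((edge G k).1 == i)%:R + ((edge G k).2 == i)%:R)
  end.

Definition half_new {R : fieldType} G (a : 'I_(gn G + gm G)) : R :=
  if split a is inr _ then 2^-1 else 0.

Lemma anchor_old {R : fieldType} G j i : anchor G (lshift _ j) i = (j == i)%:R :> R.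
Proof. by rewrite /anchor (unsplitK (inl j)). Qed.

Lemma anchor_new {R : fieldType} G k i : anchor G (rshift _ k) i =
  2^-1 * (((edge G k).1 == i)%:R + ((edge G k).2 == i)%:R) :> R.
Proof. by rewrite /anchor (unsplitK (inr k)). Qed.

Lemma half_new_old {R : fieldType} G j : half_new G (lshift _ j) = 0 :> R.
Proof. by rewrite /half_new (unsplitK (inl j)). Qed.

Lemma half_new_new {R : fieldType} G k : half_new G (rshift _ k) = 2^-1 :> R.
Proof. by rewrite /half_new (unsplitK (inr k)). Qed.

Lemma sum_anchor_mul {R : fieldType} G (y : 'I_(gn G) -> R) a :
  \sum_i y i * anchor G a i =
  match split a with
  | inl j => y j
  | inr k => 2^-1 * (at_nat y (edge G k).1 + at_nat y (edge G k).2)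
  end.
Proof.
rewrite /anchor; case: split => [j|k]; first exact: (at_natE y j).
by rewrite /at_nat -big_split mulr_sumr; apply: eq_bigr => i _ /=; ring.
Qed.

(** Distributing a unit of current conserves it, so differences of anchors are balanced. *)
Lemma sum_anchor {R : realFieldType} G a : simple_graph G ->
  \sum_i anchor G a i = 1 :> R.
Proof.
move=> sG; under eq_bigr do rewrite -[anchor _ _ _]mul1r.
rewrite sum_anchor_mul; case: split => // k.
have [u [v [_ ->]]] := edge_ends G k sG (ltn_ord k).
by rewrite !at_natE; field.
Qed.

(** Turns the case distinction on [a] into indicators, matching the edge sum met at an old vertex in
    [subdiv_potential]. *)
Lemma anchorE {R : fieldType} G a i : anchor G a i = (a == lshift _ i)%:R
  + 2^-1 * \sum_(k < gm G) (a == rshift _ k)%:R *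
     (((edge G k).1 == i)%:R + ((edge G k).2 == i)%:R) :> R.
Proof.
case: (split_ordP a) => [j|l] ->.
  rewrite anchor_old eq_lshift big1 ?mulr0 ?addr0 // => k _.
  by rewrite eq_lrshift mul0r.
rewrite anchor_new eq_rlshift add0r (bigD1 l) //= eqxx mul1r big1 ?addr0 // => k.
by rewrite eq_rshift eq_sym => /negbTE ->; rewrite mul0r.
Qed.

(** Old potentials double because each edge now has resistance 2. A midpoint takes the mean of its
    two ends, plus 1/2 per unit injected there, the resistance of two unit resistors in parallel. *)
Lemma subdiv_potential {R : realFieldType} G (a b : 'I_(gn G + gm G)) (y : 'rV[R]_(gn G)) :
  simple_graph G ->
  y *m laplacian R G = \row_i (anchor G a i - anchor G b i) ->
  (\row_z (2 * (\sum_i y 0 i * anchor G z i)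
    + half_new G z * ((z == a)%:R - (z == b)%:R)) : 'rV_(gn (subdiv G)))
  *m laplacian R (subdiv G) = dipole a b.
Proof.
move=> sG hy; set x := (X in X *m _).
pose r (k : 'I_(gm G)) : R := 2^-1 * ((rshift _ k == a)%:R - (rshift _ k == b)%:R).
have x_old j : x 0 (lshift _ j) = 2 * y 0 j.
  by rewrite mxE half_new_old sum_anchor_mul (unsplitK (inl j)) mul0r addr0.
have x_new (k : 'I_(gm G)) : x 0 (rshift _ k) =
    at_nat (y 0) (edge G k).1 + at_nat (y 0) (edge G k).2 + r k.
  by rewrite mxE half_new_new sum_anchor_mul (unsplitK (inr k)) /r; field.
clearbody x; apply/rowP => z.
rewrite laplacian_mull ?simple_subdiv //.
rewrite (sum_edges_subdiv G (fun p => (at_nat (x 0) p.1 - at_nat (x 0) p.2) * incidence p z)).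
(* Each pair of half-edges carries the current of the edge in [G], plus a flow [r k] from the
   midpoint to each end. *)
transitivity (\sum_(k < gm G) ((at_nat (y 0) (edge G k).1 - at_nat (y 0) (edge G k).2)
   * incidence (edge G k) z + r k * (2 * ((gn G + k)%N == z)%:R
      - (((edge G k).1 == z)%:R + ((edge G k).2 == z)%:R)))).
  apply: eq_bigr => k _.
  have [u [v [_ huv]]] := edge_ends G k sG (ltn_ord k).
  move: (x_new k); rewrite /incidence huv /= !at_nat_old at_nat_new !x_old => ->.
  by rewrite !at_natE; ring.
rewrite [RHS]mxE; case: (split_ordP z) => [j|l] -> /=.
  (* At an old vertex the [r] terms cancel the shares that [anchor] assigns from midpoints. *)
  have hj : (y *m laplacian R G) 0 j = anchor G a j - anchor G b j by rewrite hy mxE.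
  rewrite big_split /= -laplacian_mull // hj !anchorE.
  rewrite [lshift _ _ == a]eq_sym [lshift _ _ == b]eq_sym.
  suff -> : \sum_(k < gm G) r k * (2 * ((gn G + k)%N == j)%:R
      - (((edge G k).1 == j)%:R + ((edge G k).2 == j)%:R)) =
    2^-1 * (\sum_(k < gm G) (b == rshift _ k)%:R *
       (((edge G k).1 == j)%:R + ((edge G k).2 == j)%:R))
    - 2^-1 * (\sum_(k < gm G) (a == rshift _ k)%:R *
       (((edge G k).1 == j)%:R + ((edge G k).2 == j)%:R)) by ring.
  rewrite !mulr_sumr -sumrB; apply: eq_bigr => k _.
  have -> : (gn G + k == j)%N = false by have := ltn_ord j; lia.
  rewrite mulr0n /r [a == _]eq_sym [b == _]eq_sym; ring.
(* At a midpoint only its own edge contributes, with value [2 * r l]. *)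
rewrite (bigD1 l) //= eqxx big1 ?addr0 => [|k nkl].
  have [u [v [_ huv]]] := edge_ends G l sG (ltn_ord l).
  rewrite /incidence huv /= /r.
  have -> : (u == gn G + l :> nat)%N = false by have := ltn_ord u; lia.
  have -> : (v == gn G + l :> nat)%N = false by have := ltn_ord v; lia.
  by rewrite !mulr0n mulr1n; field.
have [u [v [_ huv]]] := edge_ends G k sG (ltn_ord k).
rewrite /incidence huv /= eqn_add2l val_eqE (negbTE nkl).
have -> : (u == gn G + l :> nat)%N = false by have := ltn_ord u; lia.
have -> : (v == gn G + l :> nat)%N = false by have := ltn_ord v; lia.
by rewrite !mulr0n; ring.
Qed.

Lemma anchor_potential {R : realFieldType} G (i0 : 'I_(gn G)) (a b : 'I_(gn G + gm G)) :
  simple_graph G -> solvable_graph R G ->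
  (\row_i (anchor G a i - anchor G b i) <= laplacian R G)%MS.
Proof.
move=> sG hG; apply: (balanced_submx G i0 _ hG).
by under eq_bigr do rewrite mxE; rewrite sumrB !sum_anchor ?subrr.
Qed.

Lemma solvable_subdiv {R : realFieldType} G (i0 : 'I_(gn G)) :
  simple_graph G -> solvable_graph R G -> solvable_graph R (subdiv G).
Proof.
move=> sG hG a b; have /submxP [y hy] := anchor_potential G i0 a b sG hG.
by rewrite -(subdiv_potential G a b y sG (esym hy)) submxMl.
Qed.

(** For distinct vertices [subdiv_potential] gives twice the pairing of [y] with [c], plus
    [s a + s b]. That pairing is [- W c c / 2], which expands bilinearly. For [a = b] the last term
    makes the right side vanish. *)
Lemma resistance_subdiv {R : realFieldType} G (i0 : 'I_(gn G)) (a b : 'I_(gn G + gm G))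
  (W := weighted_resistance G) (s := half_new G : _ -> R) :
  simple_graph G -> solvable_graph R G ->
  resistance R (subdiv G) a b = 2 * W (anchor G a) (anchor G b)
   + (s a - W (anchor G a) (anchor G a)) + (s b - W (anchor G b) (anchor G b))
   - (a == b)%:R * (2 * s a).
Proof.
move=> sG hG; case: (eqVneq a b) => [<-|nab]; first by rewrite resistance_diag mulr1n; ring.
pose c i := anchor G a i - anchor G b i : R.
pose y := \row_i c i *m pinvmx (laplacian R G).
have hy : y *m laplacian R G = \row_i c i by rewrite mulmxKpV ?anchor_potential.
rewrite (resistance_potential _ _ _ _ (simple_subdiv G sG) (subdiv_potential G a b y sG hy)).
rewrite !mxE !eqxx [b == a]eq_sym (negbTE nab) mulr1n mulr0n -/(s a) -/(s b).
have hc : W c c = - 2 * \sum_i y 0 i * c i.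
  rewrite /W weighted_resistance_balanced; last by rewrite sumrB !sum_anchor ?subrr.
  congr (_ * _); rewrite exchange_big; apply: eq_bigr => j _ /=.
  by rewrite mxE mulr_suml; apply: eq_bigr => i _; rewrite [(\row_i c i) _ _]mxE; ring.
have hcab : W c c = W (anchor G a) (anchor G a) + W (anchor G b) (anchor G b)
    - 2 * W (anchor G a) (anchor G b).
  have -> : 2 * W (anchor G a) (anchor G b) = W (anchor G a) (anchor G b) + W (anchor G b) (anchor G a).
    rewrite mulr2n mulrDl mul1r; congr (_ + _); rewrite /W /weighted_resistance exchange_big.
    by apply: eq_bigr => i _; apply: eq_bigr => j _ /=; rewrite resistance_sym; ring.
  rewrite /W /weighted_resistance -!big_split -sumrB /=; apply: eq_bigr => i _.
  by rewrite -!big_split -sumrB /=; apply: eq_bigr => j _; rewrite /c; ring.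
move: hc; rewrite hcab.
have -> : \sum_i y 0 i * c i = \sum_i y 0 i * anchor G a i - \sum_i y 0 i * anchor G b i.
  by rewrite -sumrB; apply: eq_bigr => i _; rewrite /c; ring.
lra.
Qed.

(** * Degrees and weighted resistances of the subdivision *)

Lemma degree_sum {R : fieldType} G : simple_graph G ->
  \sum_(i < gn G) (deg G i)%:R = 2 * (gm G)%:R :> R.
Proof.
move=> sG; under eq_bigr do rewrite degE //.
rewrite exchange_big /=; transitivity (\sum_(k < gm G) (2 : R)).
  apply: eq_bigr => k _.
  have [u [v [_ ->]]] := edge_ends G k sG (ltn_ord k).
  under eq_bigr do rewrite -[X in X + _]mul1r -[X in _ + X]mul1r.
  by rewrite big_split; congr (_ + _); exact: (at_natE (fun=> 1)).
by rewrite sumr_const card_ord mulr_natr.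
Qed.

Lemma deg_subdiv_old {R : fieldType} G (i : 'I_(gn G)) : simple_graph G ->
  (deg (subdiv G) i)%:R = (deg G i)%:R :> R.
Proof.
move=> sG; rewrite !degE ?simple_subdiv //.
rewrite (sum_edges_subdiv G (fun p => (p.1 == i :> nat)%:R + (p.2 == i :> nat)%:R)).
apply: eq_bigr => k _ /=.
have -> : (gn G + k == i)%N = false by have := ltn_ord i; lia.
by rewrite addr0 add0r.
Qed.

Lemma deg_subdiv_new {R : fieldType} G (k : 'I_(gm G)) : simple_graph G ->
  (deg (subdiv G) (gn G + k))%:R = 2 :> R.
Proof.
move=> sG; rewrite degE ?simple_subdiv //.
rewrite (sum_edges_subdiv G (fun p => (p.1 == gn G + k)%N%:R + (p.2 == gn G + k)%N%:R)).
have ends (l : 'I_(gm G)) : ((edge G l).1 == gn G + k)%N = false /\ ((edge G l).2 == gn G + k)%N = false.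
  by have [hu hv _] := edge_bounds G l sG (ltn_ord l); split; lia.
rewrite (bigD1 k) //= big1 => [|l nlk].
  by have [-> ->] := ends k; rewrite eqxx mulr0n mulr1n; ring.
by have [-> ->] := ends l; rewrite eqn_add2l val_eqE (negbTE nlk) !addr0.
Qed.

(** Bilinear extension of [resistance_subdiv]: [Phi] pushes weights to old vertices, the [t] terms
    factor, and the diagonal correction leaves a single sum. *)
Lemma weighted_resistance_subdiv {R : realFieldType} G (i0 : 'I_(gn G))
  (f g : 'I_(gn G + gm G) -> R) (s := half_new G)
  (t := fun a => s a - weighted_resistance G (anchor G a) (anchor G a))
  (Phi := fun (h : 'I_(gn G + gm G) -> R) i => \sum_a h a * anchor G a i) :
  simple_graph G -> solvable_graph R G ->
  weighted_resistance (subdiv G) f g = 2 * weighted_resistance G (Phi f) (Phi g)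
    + (\sum_a f a * t a) * (\sum_a g a) + (\sum_a f a) * (\sum_a g a * t a)
    - 2 * \sum_a f a * g a * s a.
Proof.
move=> sG hG.
have -> : weighted_resistance G (Phi f) (Phi g) =
    \sum_a \sum_b f a * g b * weighted_resistance G (anchor G a) (anchor G b).
  transitivity (\sum_i \sum_j \sum_a \sum_b
      f a * g b * (anchor G a i * anchor G b j * resistance R G i j)).
    apply: eq_bigr => i _; apply: eq_bigr => j _.
    rewrite /Phi !mulr_suml; apply: eq_bigr => a _.
    by rewrite mulr_sumr mulr_suml; apply: eq_bigr => b _; ring.
  under eq_bigr do rewrite exchange_big /=.
  rewrite exchange_big /=; apply: eq_bigr => a _.
  under eq_bigr do rewrite exchange_big /=.
  rewrite exchange_big /=; apply: eq_bigr => b _.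
  by rewrite mulr_sumr; apply: eq_bigr => i _; rewrite mulr_sumr.
rewrite !mulr_suml !mulr_sumr -!big_split -sumrB /=; apply: eq_bigr => a _.
have -> : 2 * (f a * g a * s a) = \sum_b f a * g b * ((a == b)%:R * (2 * s a)).
  rewrite (bigD1 a) //= eqxx mulr1n big1 ?addr0 => [|b]; first by ring.
  by rewrite eq_sym => /negbTE ->; rewrite mulr0n !mul0r mulr0.
rewrite !mulr_sumr -!big_split -sumrB /=; apply: eq_bigr => b _.
by rewrite (resistance_subdiv G i0) // /t -/s; ring.
Qed.

Lemma weighted_resistance_point {R : fieldType} G (u : 'I_(gn G)) :
  weighted_resistance G (fun i => (u == i)%:R) (fun i => (u == i)%:R) = 0 :> R.
Proof.
rewrite /weighted_resistance big1 // => i _; rewrite big1 // => j _.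
have [<-|_] := eqVneq u i; last by rewrite !mul0r.
by have [<-|_] := eqVneq u j; rewrite ?resistance_diag ?mulr0 ?mul0r.
Qed.

Lemma anchor_old_resistance {R : fieldType} G (j : 'I_(gn G)) :
  weighted_resistance G (anchor G (lshift _ j)) (anchor G (lshift _ j)) = 0 :> R.
Proof.
rewrite -[RHS](weighted_resistance_point G j).
by apply: eq_bigr => i _; apply: eq_bigr => l _; rewrite !anchor_old.
Qed.

Lemma sum_anchor_new_resistance {R : realFieldType} G (i0 : 'I_(gn G)) :
  simple_graph G -> solvable_graph R G ->
  \sum_(k < gm G) weighted_resistance G (anchor G (rshift _ k)) (anchor G (rshift _ k))
  = 2^-1 * ((gn G)%:R - 1) :> R.
Proof.
move=> sG hG.
(* For an edge uv the anchor form is half of Omega_uv and the incidence form is -2 Omega_uv, hence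
   the ratio -1/4. *)
have -> : 2^-1 * ((gn G)%:R - 1) = - 4^-1 * (- 2 * ((gn G)%:R - 1)) :> R by field.
rewrite -(sum_edge_balanced G i0 sG hG) mulr_sumr; apply: eq_bigr => k _.
have [u [v [_ huv]]] := edge_ends G k sG (ltn_ord k).
have pu := weighted_resistance_point (R := R) G u.
have pv := weighted_resistance_point (R := R) G v.
(* Parallelogram law: the squares of half the sum and half the difference of two point masses add up
   to half of each square, and point masses have form 0. *)
apply/eqP; rewrite -subr_eq0; apply/eqP.
transitivity (2^-1 * weighted_resistance G (fun i => (u == i)%:R) (fun i => (u == i)%:R)
  + 2^-1 * weighted_resistance G (fun i => (v == i)%:R) (fun i => (v == i)%:R) : R);
  last by rewrite pu pv; ring.
rewrite /weighted_resistance !mulr_sumr -sumrB -big_split; apply: eq_bigr => i _ /=.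
rewrite !mulr_sumr -sumrB -big_split; apply: eq_bigr => j _ /=.
by rewrite !anchor_new /incidence huv /= !val_eqE; field.
Qed.

Lemma sum_anchor_weighted {R : realFieldType} G (f : 'I_(gn G + gm G) -> R) c i :
  simple_graph G -> (forall k, f (rshift _ k) = c) ->
  \sum_a f a * anchor G a i = f (lshift _ i) + c / 2 * (deg G i)%:R.
Proof.
move=> sG hf; rewrite big_split_ord /=; congr (_ + _).
  under eq_bigr do rewrite anchor_old.
  rewrite (bigD1 i) //= eqxx mulr1 big1 ?addr0 // => j /negbTE ->.
  by rewrite mulr0.
rewrite degE // mulr_sumr; apply: eq_bigr => k _.
by rewrite hf anchor_new mulrA.
Qed.

(** Covers both the degrees, equal to 2 on midpoints, and the constant 1. By Foster the t_a sum to
    (m - n + 1)/2 over midpoints, and they vanish on old vertices. *)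
Lemma weighted_resistance_subdiv_const {R : realFieldType} G (i0 : 'I_(gn G))
  (f g : 'I_(gn G + gm G) -> R) (c e : R) (n := (gn G)%:R) (m := (gm G)%:R)
  (d := fun i : 'I_(gn G) => (deg G i)%:R) :
  simple_graph G -> solvable_graph R G ->
  (forall k, f (rshift _ k) = c) -> (forall k, g (rshift _ k) = e) ->
  weighted_resistance (subdiv G) f g =
  2 * weighted_resistance G (fun i => f (lshift _ i) + c / 2 * d i)
        (fun i => g (lshift _ i) + e / 2 * d i)
  + (m - n + 1) / 2 * (c * (\sum_i g (lshift _ i) + e * m)
       + e * (\sum_i f (lshift _ i) + c * m))
  - c * e * m.
Proof.
move=> sG hG hf hg; rewrite (weighted_resistance_subdiv G i0) //.
have ht (h : 'I_(gn G + gm G) -> R) b : (forall k, h (rshift _ k) = b) ->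
    \sum_a h a * (half_new G a - weighted_resistance G (anchor G a) (anchor G a))
    = b * ((m - n + 1) / 2).
  move=> hh; rewrite big_split_ord /= big1 ?add0r => [|j _]; last first.
    by rewrite half_new_old anchor_old_resistance subr0 mulr0.
  under eq_bigr do rewrite hh half_new_new.
  rewrite -mulr_sumr sumrB (sum_anchor_new_resistance G i0) // sumr_const card_ord.
  by rewrite -mulr_natr -/m -/n; field.
have hsum (h : 'I_(gn G + gm G) -> R) b : (forall k, h (rshift _ k) = b) ->
    \sum_a h a = \sum_i h (lshift _ i) + b * m.
  move=> hh; rewrite big_split_ord /=; congr (_ + _).
  by under eq_bigr do rewrite hh; rewrite sumr_const card_ord mulr_natr.
rewrite (ht f c) // (ht g e) // (hsum f c) // (hsum g e) //.
have -> : \sum_a f a * g a * half_new G a = c * e * m / 2.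
  rewrite big_split_ord /= big1 ?add0r => [|j _]; last by rewrite half_new_old mulr0.
  under eq_bigr do rewrite hf hg half_new_new.
  by rewrite sumr_const card_ord -mulr_natr -/m; ring.
have -> : weighted_resistance G (fun i => \sum_a f a * anchor G a i)
     (fun i => \sum_a g a * anchor G a i)
   = weighted_resistance G (fun i => f (lshift _ i) + c / 2 * d i)
        (fun i => g (lshift _ i) + e / 2 * d i).
  apply: eq_bigr => i _; apply: eq_bigr => j _.
  by rewrite (sum_anchor_weighted G f c) // (sum_anchor_weighted G g e).
by field.
Qed.

(** * Recurrences for the two indices and their solution *)

Lemma Rstar_subdiv {R : realFieldType} G (i0 : 'I_(gn G))
  (n : R := (gn G)%:R) (m : R := (gm G)%:R) :
  simple_graph G -> solvable_graph R G ->
  Rstar R (subdiv G) = 8 * Rstar R G + 2 * m * (2 * m - 2 * n + 1).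
Proof.
move=> sG hG; rewrite !RstarE.
rewrite (weighted_resistance_subdiv_const G i0 _ _ 2 2) //; try by move=> k; exact: deg_subdiv_new.
have -> : \sum_(i < gn G) (deg (subdiv G) (lshift (gm G) i))%:R = 2 * m :> R.
  by rewrite -degree_sum //; apply: eq_bigr => i _; rewrite deg_subdiv_old.
set W := weighted_resistance G _ _; set W0 := weighted_resistance G _ _.
(* Both weights are d + (2/2) d = 2d. *)
have -> : W = 4 * W0.
  rewrite /W0 /weighted_resistance mulr_sumr; apply: eq_bigr => i _.
  rewrite mulr_sumr; apply: eq_bigr => j _.
  by rewrite !deg_subdiv_old //; field.
by rewrite -/n -/m; field.
Qed.

Lemma Rplus_subdiv {R : realFieldType} G (i0 : 'I_(gn G))
  (n : R := (gn G)%:R) (m : R := (gm G)%:R) :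
  simple_graph G -> solvable_graph R G ->
  Rplus R (subdiv G) = 4 * Rplus R G + 4 * Rstar R G
    + 2 * m * (2 * m - 2 * n + 1) - (m - n) * (m - n + 1).
Proof.
move=> sG hG; rewrite !RplusE RstarE.
rewrite (weighted_resistance_subdiv_const G i0 _ _ 2 1) //; try by move=> k; exact: deg_subdiv_new.
have -> : \sum_(i < gn G) (deg (subdiv G) (lshift (gm G) i))%:R = 2 * m :> R.
  by rewrite -degree_sum //; apply: eq_bigr => i _; rewrite deg_subdiv_old.
rewrite sumr_const card_ord -/n.
set W := weighted_resistance G _ _; set W1 := weighted_resistance G _ _.
set W0 := weighted_resistance G _ _.
(* The weights are 2d and 1 + d/2. *)
have -> : W = 2 * W1 + W0.
  rewrite /W /W0 /W1 /weighted_resistance mulr_sumr -big_split; apply: eq_bigr => i _ /=.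
  rewrite mulr_sumr -big_split; apply: eq_bigr => j _ /=.
  by rewrite !deg_subdiv_old //; field.
by rewrite -/m; field.
Qed.

Theorem theorem3p3 (R : realFieldType) (G : graph) (k : nat) :
  simple_graph G -> (2 <= gn G)%N -> gconnected G ->
  let n : R := (gn G)%:R in
  let m : R := (gm G)%:R in
  Rplus R (subdiv_iter k G) =
    4 ^+ k * Rplus R G + (8 ^+ k - 4 ^+ k) * Rstar R G
    + (8 ^+ k - 2 ^+ k) / 3 * m * (2 * m - 2 * n + 1)
    - (4 ^+ k - 1) / 3 * (m - n) * (m - n + 1).
Proof.
move=> sG n_ge2 cG n m.
(* The induction carries [Rstar], which feeds the recurrence of [Rplus], and both sizes; the vertex
   count encodes the invariance of m - n. *)
suff: [/\ simple_graph (subdiv_iter k G),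
    solvable_graph R (subdiv_iter k G), (0 < gn (subdiv_iter k G))%N,
    (gm (subdiv_iter k G))%:R = 2 ^+ k * m
  & (gn (subdiv_iter k G))%:R = 2 ^+ k * m - (m - n) /\
    Rstar R (subdiv_iter k G) =
      8 ^+ k * Rstar R G + (8 ^+ k - 2 ^+ k) / 3 * m * (2 * m - 2 * n + 1) /\
    Rplus R (subdiv_iter k G) =
      4 ^+ k * Rplus R G + (8 ^+ k - 4 ^+ k) * Rstar R G
      + (8 ^+ k - 2 ^+ k) / 3 * m * (2 * m - 2 * n + 1)
      - (4 ^+ k - 1) / 3 * (m - n) * (m - n + 1)] by case=> _ _ _ _ [_ []].
elim: k => [|k [sH hH H0 mH [nH [starH plusH]]]].
  split=> //=; first exact: connected_solvable.
  - exact: ltnW.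
  - by rewrite expr0 mul1r.
  - by rewrite !expr0; split; [ring | split; field].
rewrite /subdiv_iter iterS -/(subdiv_iter k G).
set H := subdiv_iter k G in sH hH H0 mH nH starH plusH *.
pose i0 := Ordinal H0.
split.
- exact: simple_subdiv.
- exact: solvable_subdiv.
- by rewrite /= ltn_addr.
- by rewrite gm_subdiv natrM mH exprS mulrA.
split; first by rewrite /= natrD mH nH exprS; ring.
rewrite (Rstar_subdiv H i0) // (Rplus_subdiv H i0) // starH plusH mH nH !exprS.
by split; field.
Qed.
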